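(* Let $e\in [1,(5+\sqrt{5})/2)$ be a real number. Then there are natural numbers $N$ and $k$, depending only on $e$, such that for every Sturmian word $\mathbf{x}$, the maximum gap between consecutive ending positions of $e$-powers of period at most $k$ in $\mathbf{x}$ is at most $N$.
   Context: Words. For a finite word $w = w[0..n-1]$ of length $n\ge 1$, a positive integer $p \le n$ is a period of $w$ if $w[i]=w[i+p]$ for all $i\in\{0,\ldots,n-p-1\}$; the smallest period is denoted $\mathrm{per}(w)$ and called the period of $w$. For a real number $e\ge 1$, $w$ is an $e$-power if $\lceil e\cdot \mathrm{per}(w)\rceil = |w|$, where $|w|$ is the length of $w$. An $e$-power $w$ has period at most $k$ if $\mathrm{per}(w)\le k$. A factor of a word is a block of consecutive letters occurring in it. Sturmian words. A Sturmian word is a (right-)infinite word $\mathbf{x}=\mathbf{x}[0]\mathbf{x}[1]\mathbf{x}[2]\cdots$ over $\{0,1\}$ having exactly $n+1$ distinct factors of length $n$ for every $n\ge 0$ (equivalently, an infinite aperiodic binary balanced word). Gaps. An $e$-power of period at most $k$ ends at position $n$ in $\mathbf{x}$ if there is $m$ with $1\le m\le n$ such that the factor $\mathbf{x}[n-m]\cdots\mathbf{x}[n-1]$ is an $e$-power of period at most $k$. Let $p_1<p_2<\cdots$ be the list of all such positions. ''The maximum gap is at most $N$'' means that this list is infinite and $p_{i+1}-p_i\le N$ for all $i\ge 1$. *)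

(* Defs.v *)
From mathcomp Require Import all_boot all_order all_algebra.
From mathcomp Require Import boolp classical_sets functions cardinality reals.

Set Implicit Arguments.
Unset Strict Implicit.
Unset Printing Implicit Defensive.

Import Order.TTheory GRing.Theory Num.Theory.

Local Open Scope classical_set_scope.
Local Open Scope card_scope.

(* Finite words over {0,1} are of type seq bool, infinite ones nat -> bool. *)

Definition is_period (w : seq bool) (p : nat) : Prop :=
  [/\ 0 < p, p <= size w &
      forall i, i + p < size w -> nth false w i = nth false w (i + p)].

(* The whole length is a period of a nonempty word, so the default value of
   the minimum is harmless there (see perP); per [::] = 0 is a junk value. *)
Definition per (w : seq bool) : nat :=
  \big[minn/size w]_(1 <= p < (size w).+1 | `[< is_period w p >]) p.

Lemma perP (w : seq bool) : 0 < size w ->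
  is_period w (per w) /\ forall p, is_period w p -> per w <= p.
Proof.
move=> w_gt0; split.
  rewrite /per; elim/big_ind: _ => [|p q Pp Pq|p /asboolP //].
    split=> // i; rewrite -[X in _ < X]add0n ltn_add2r //.
  by rewrite /minn; case: ifP.
move=> p Pp; rewrite /per.
have : p \in index_iota 1 (size w).+1.
  by case: Pp => p0 ps _; rewrite mem_index_iota p0 ltnS.
elim: (index_iota _ _) => // q s IH; rewrite inE big_cons => /orP[/eqP<-|/IH].
  by rewrite asboolT // geq_minl.
by case: ifP => // _ le_p; exact: leq_trans (geq_minr _ _) le_p.
Qed.

Definition epower (R : realType) (e : R) (w : seq bool) : Prop :=
  0 < size w /\ (Num.ceil (e * (per w)%:R) = (size w)%:Z)%R.

(* The block x[i] ... x[i + n - 1] of length n starting at position i. *)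
Definition factor (x : nat -> bool) (i n : nat) : seq bool :=
  mkseq (fun j => x (i + j)) n.

Definition sturmian (x : nat -> bool) : Prop :=
  forall n, range (fun i => factor x i n) #= `I_n.+1.

Definition ending_positions (R : realType) (e : R) (k : nat)
    (x : nat -> bool) : set nat :=
  [set n | exists m, [/\ 1 <= m <= n, epower e (factor x (n - m) m) &
                         per (factor x (n - m) m) <= k]].

Definition max_gap_le (P : set nat) (N : nat) : Prop :=
  infinite_set P /\
  forall p q, P p -> P q -> p < q -> (forall r, p < r < q -> ~ P r) ->
    q - p <= N.

(* Main.v *)
(* The language L of factors of a Sturmian word x is
   factorial, irreducible, and has one right special word of each length.
   If 11 is not in L, decoding along sigma : 0 -> 0, 1 -> 01 yields a language
   of the same kind, so L is covered by concatenations of two words u, v obtained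
   from 0, 1 by steps (u, v) -> (u, uv) and exchanges; uv and vu agree except on
   their last two letters. If 0^m is the longest run of 0 in the decoded language,
   then every inner run has length at least m - 1, and 0^m followed by 10 produces
   a word of period |u| and exponent m + 1 + (|v| - 2) / |u|. Either such words
   occur in every long window, or some long window avoids 0^m, which creates a long
   run, hence a large power, at a later level. For m >= 3 the exponent is at least
   4; for m = 2 it is close to 3 + |v| / |u|, and with t = (sqrt 5 - 1) / 2 (so
   1 / (1 + t) = t) one of |v| / |u| and the next ratio 1 / (1 + |v| / |u|) is at
   least t, while 3 + t = (5 + sqrt 5) / 2. All levels and lengths involved are
   bounded in terms of e only. *)
Require Import Defs.
From mathcomp Require Import all_boot all_order all_algebra.
From mathcomp Require Import boolp classical_sets functions cardinality reals.
From mathcomp Require Import zify lra.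

Set Implicit Arguments.
Unset Strict Implicit.
Unset Printing Implicit Defensive.

Import Order.TTheory GRing.Theory Num.Theory.

(** * Languages of Sturmian type, and parsing along [sigma] *)

Definition right_special (L : seq bool -> Prop) (u : seq bool) : Prop :=
  forall b, L (rcons u b).

(** [lang_special] asks for at most one right special word of each length, so languages of periodic
    words qualify too. *)
Record sturm_lang (L : seq bool -> Prop) : Prop := SturmLang {
  lang_factor : forall u v w, L (u ++ v ++ w) -> L v;
  lang_connect : forall u v, L u -> L v -> exists w, L (u ++ w ++ v);
  lang_letter : exists b, L [:: b];
  lang_special : forall u v, size u = size v ->
    right_special L u -> right_special L v -> u = v }.

Definition expand (u v w : seq bool) : seq bool :=
  flatten [seq if b then v else u | b : bool <- w].

Definition sigma : seq bool -> seq bool := expand [:: false] [:: false; true].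

(* The trailing 0 is the letter that starts the sigma-image of any continuation. *)
Definition desub (L : seq bool -> Prop) (w : seq bool) : Prop :=
  L (rcons (sigma w) false).

Lemma expand_cat u v w1 w2 :
  expand u v (w1 ++ w2) = expand u v w1 ++ expand u v w2.
Proof. by rewrite /expand map_cat flatten_cat. Qed.

(** Decoding along [sigma] thus replaces the pair (u, v) by (u, uv). *)
Lemma expand_sigma u v w : expand u v (sigma w) = expand u (u ++ v) w.
Proof.
elim: w => // b w IH; rewrite -cat1s /sigma !expand_cat IH; congr (_ ++ _).
by case: b; rewrite /expand /= !cats0.
Qed.

Lemma expand_negb u v w : expand v u (map negb w) = expand u v w.
Proof. by rewrite /expand -map_comp; congr flatten; apply: eq_map; case. Qed.

Lemma expand_id w : expand [:: false] [:: true] w = w.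
Proof. by elim: w => // -[] w IH; rewrite -{2}IH. Qed.

Lemma expand_nseq u v m : expand u v (nseq m false) = flatten (nseq m u).
Proof. by rewrite /expand map_nseq. Qed.

Lemma infix_expand u v w1 w2 :
  infix w1 w2 -> infix (expand u v w1) (expand u v w2).
Proof.
by move=> /infixP[p [s ->]]; rewrite !expand_cat; apply/infixP; do 2!eexists.
Qed.

(** Without 11, cutting before every 0 leaves blocks 0 and 01, the last one being the single final
    0. *)
Lemma sigma_parse s : ~~ infix [:: true; true] (false :: s) ->
  last false s = false ->
  exists2 w, false :: s = rcons (sigma w) false & size s <= 2 * size w.
Proof.
have [n] := ubnP (size s); elim: n s => // n IH [|[] s] sz ni ls.
- by exists [::].
- case: s sz ls ni => [|[] s] //= sz ls ni; first by rewrite prefix0s in ni.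
  have [||w e1 e2] := IH s _ _ ls; [lia | |].
    by apply: contra ni; exact: (@infix_catl _ _ _ [:: true]).
  by exists (true :: w); rewrite /= ?e1 //; lia.
- have [||w e1 e2] := IH s _ _ ls; [by move: sz => /=; lia | |].
    by apply: contra ni; exact: (@infix_catl _ _ _ [:: false]).
  by exists (false :: w); rewrite /= ?e1 //; lia.
Qed.

(** The last letter of an image is the last letter of its preimage, so both words can be peeled from
    the right. *)
Lemma sigma_suffix_inj s w1 w2 :
  size w1 = size w2 -> sigma w1 = s ++ sigma w2 -> w1 = w2.
Proof.
elim/last_ind: w1 w2 => [|w1 a IH] w2; first by case: w2.
case/lastP: w2 => [|w2 b]; first by rewrite size_rcons.
rewrite !size_rcons -!cats1 /sigma !expand_cat => -[sz] E.
have ab : a = b.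
  have := congr1 (last false) E; rewrite !last_cat.
  by case: (a) (b) => -[].
rewrite -ab in E *; congr (_ ++ _); apply: IH => //.
have := E; rewrite catA => /eqP; rewrite eqseq_cat => [/andP[/eqP]//|].
have := congr1 size E; rewrite !size_cat; case: (a) => /=; lia.
Qed.

(** * Runs of 0 *)

Lemma zero_run_suffix u m : exists2 n,
  m <= n & suffix (true :: nseq n false) (true :: u ++ nseq m false).
Proof.
elim/last_ind: u m => [|u [] IH] m.
- by exists m; rewrite // suffix_refl.
- by exists m; rewrite // cat_rcons -cat_cons suffix_suffix.
- by have [n n1 n2] := IH m.+1; exists n; rewrite ?cat_rcons // ltnW.
Qed.

Lemma zero_run_prefix u m : exists2 n,
  m <= n & prefix (rcons (nseq n false) true) (nseq m false ++ rcons u true).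
Proof.
elim: u m => [|[] u IH] m.
- by exists m; rewrite // cats1 prefix_refl.
- by exists m; rewrite // -cat_rcons prefix_prefix.
- have [n n1 n2] := IH m.+1; exists n; first by rewrite ltnW.
  by move: n2; rewrite -[m.+1]addn1 nseqD -catA.
Qed.

Lemma zero_run_or s m : m <= size s -> prefix (nseq m false) s \/
  exists j s', j < m /\ s = nseq j false ++ true :: s'.
Proof.
elim: m s => [|m IH] s; first by left; rewrite prefix0s.
case: s => [|[] s] //=.
- by right; exists 0, s.
- rewrite ltnS => /IH [h|[j [s' [jm ->]]]]; first by left.
  by right; exists j.+1, s'.
Qed.

Section Language.
Context (L : seq bool -> Prop) (hL : sturm_lang L).

Lemma lang_infix u v : infix u v -> L v -> L u.
Proof. by move=> /infixP[p [s ->]]; apply: lang_factor. Qed.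

Lemma lang_nil : L [::].
Proof. by have [b] := lang_letter hL; apply: lang_infix. Qed.

Lemma lang_extr u : L u -> exists b, L (rcons u b).
Proof.
have [b Lb] := lang_letter hL; move=> Lu; have [w] := lang_connect hL Lu Lb.
case: w => [|c w] h; [exists b | exists c]; apply: lang_infix h.
  by rewrite -cats1 infix_refl.
by apply/infixP; exists [::], (w ++ [:: b]); rewrite -cats1 -!catA.
Qed.

Lemma right_special_suffix u v : right_special L (u ++ v) -> right_special L v.
Proof.
by move=> h b; apply: lang_infix (h b); rewrite rcons_cat suffix_infix.
Qed.

(** Otherwise 1 0^j and 0^(j+1) would both be right special: joining 1 and 0^m in both orders yields
    1 0^j 0 and 0^(j+1) 1, while 0^m contains 0^(j+2). *)
Lemma zero_runs m j : L (nseq m false) -> j.+1 < m ->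
  ~ L (true :: rcons (nseq j false) true).
Proof.
move=> Lm jm Lj.
have Lt : L [:: true] by apply: lang_infix Lj; exact: (prefix_infix [:: _]).
suff : true :: nseq j false = nseq j.+1 false by [].
apply: (lang_special hL); rewrite ?size_nseq //= ?size_nseq // => -[] //.
- have [w] := lang_connect hL Lt Lm; have [n nm] := zero_run_suffix w m.
  move=> /suffixW n2 /(lang_infix n2); apply: lang_infix.
  have -> : n = j + 1 + (n - j.+1) by lia.
  by rewrite !nseqD -cat_cons -cats1 -cat_cons prefix_infix.
- have [w] := lang_connect hL Lm Lt; rewrite cats1.
  have [n nm /prefixW n2 /(lang_infix n2)] := zero_run_prefix w m.
  apply: lang_infix; have -> : n = (n - j.+1) + j.+1 by lia.
  by rewrite nseqD rcons_cat suffix_infix.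
- apply: lang_infix Lm; have -> : m = j.+1 + 1 + (m - j.+2) by lia.
  by rewrite !nseqD -[rcons _ _]cats1 prefix_infix.
Qed.

Lemma no_ff_tt : L [:: false; false] -> ~ L [:: true; true].
Proof. by move=> h; apply: (@zero_runs 2 0). Qed.

(** If the first m letters are not 0^m they contain a 1; after the first 1 comes either 0^m or a run
    closed too early, which [zero_runs] excludes. *)
Lemma long_run m w : L (nseq m.+1 false) -> L w -> 2 * m <= size w ->
  infix (nseq m false) w.
Proof.
move=> Lm Lw sw; have /zero_run_or[/prefixW//|[i [s [im Ew]]]] : m <= size w by lia.
move: sw; rewrite Ew size_cat size_nseq /= => sw.
have /zero_run_or[/prefixW h|[j [t [jm Es]]]] : m <= size s by lia.
  by rewrite -cat_rcons; apply: infix_catl.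
case: (@zero_runs m.+1 j) => //; apply: lang_infix Lw.
rewrite Ew Es; apply: infix_catl; rewrite -cat_rcons -cat_cons; exact: prefix_infix.
Qed.

Lemma lang_extrn u n : L u -> exists v, size v = n /\ L (u ++ v).
Proof.
move=> Lu; elim: n => [|n [v [<- Lv]]]; first by exists [::]; rewrite cats0.
have [b Lb] := lang_extr Lv; exists (rcons v b).
by rewrite size_rcons -rcons_cat.
Qed.

(** * Decoding preserves the class of languages *)

Context (no_tt : ~ L [:: true; true]).

Lemma lang_no_tt w : L w -> ~~ infix [:: true; true] w.
Proof. by move=> Lw; apply/negP => /lang_infix /(_ Lw). Qed.

Lemma desub_factor u v w : desub L (u ++ v ++ w) -> desub L v.
Proof.
rewrite /desub /sigma !expand_cat !rcons_cat => h.
suff [t Et] : exists t, rcons (sigma w) false = false :: t.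
  move: h; rewrite Et -cat_rcons; exact: (lang_factor hL).
by case: w {h} => [|[] w]; eexists.
Qed.

Lemma desub_connect u v : desub L u -> desub L v ->
  exists w, desub L (u ++ w ++ v).
Proof.
move=> Lu Lv; have [w Lw] := lang_connect hL Lu Lv.
have [t Et] : exists t, rcons (sigma v) false = false :: t.
  by case: v {Lv Lw} => [|[] v]; eexists.
(* The parsed word runs from the 0 that closes the image of [u] to the 0 that opens the image of
   [v]. *)
have [||w' E _] := @sigma_parse (rcons w false).
- apply/lang_no_tt/(lang_infix _ Lw)/infixP; exists (sigma u), t.
  by rewrite cat_rcons Et /= cat_rcons.
- by rewrite last_rcons.
exists w'; rewrite /desub /sigma !expand_cat !rcons_cat.
by move: E; rewrite /sigma -rcons_cons => /rcons_inj[<-]; rewrite -cat_rcons.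
Qed.

(** If w is right special after decoding, then [sigma w] followed by 0 is right special in [L]. The
    longer of the two images is cut to a suffix of the length of the other, which stays right
    special, so the two agree and [sigma_suffix_inj] applies. *)
Lemma desub_special u v : size u = size v -> right_special (desub L) u ->
  right_special (desub L) v -> u = v.
Proof.
have rs w : right_special (desub L) w -> right_special L (rcons (sigma w) false).
  move=> h [].
    have := h true; rewrite /desub -[rcons w _]cats1 /sigma expand_cat.
    apply: lang_infix; rewrite -[rcons (_ ++ _) _]cats1 -[rcons (rcons _ _) _]cats1.
    by rewrite cat_rcons /= prefix_infix.
  by have := h false; rewrite /desub -[rcons w _]cats1 /sigma expand_cat cats1.
wlog le : u v / size (sigma v) <= size (sigma u).
  move=> th suv hu hv; case: (leqP (size (sigma v)) (size (sigma u))) => [le|/ltnW le].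
    exact: th.
  by apply/esym/th.
move=> suv hu hv.
apply: (@sigma_suffix_inj (take (size (sigma u) - size (sigma v)) (sigma u))) => //.
rewrite -[LHS](cat_take_drop (size (sigma u) - size (sigma v))); congr (_ ++ _).
move/rs in hu; move/rs in hv.
apply: (@rcons_injl _ false); apply: (lang_special hL) => //.
  by rewrite !size_rcons size_drop subKn.
by apply: (@right_special_suffix (take (size (sigma u) - size (sigma v)) (sigma u)));
  rewrite -rcons_cat cat_take_drop.
Qed.

Lemma desub_letter : exists b, desub L [:: b].
Proof.
have L0 : L [:: false].
  have [[] // Lb] := lang_letter hL.
  have [[] //] := lang_extr Lb; apply: lang_infix.
  exact: (suffix_infix [:: true]).
have [[] L1] := lang_extr L0; last by exists false.
have [[] L2] := lang_extr L1; last by exists true.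
by case: no_tt; apply: lang_infix L2; exact: (suffix_infix [:: false]).
Qed.

Lemma desub_lang : sturm_lang (desub L).
Proof.
split; [exact: desub_factor | exact: desub_connect | exact: desub_letter |].
exact: desub_special.
Qed.

(** Dropping at most one letter at each end gives a word that begins and ends with 0 and hence
    parses; the constant 3 counts these two letters and the final 0. *)
Lemma desub_long w n : L w -> 2 * n + 3 <= size w ->
  exists2 w', desub L w' & n <= size w' /\ infix (rcons (sigma w') false) w.
Proof.
move=> Lw sw.
have [s i1 s1] : exists2 s, infix (false :: s) w & size w <= (size s).+2.
  case: w Lw sw => [|[] w] Lw sw; [by move: sw; rewrite addn3 | |].
    case: w Lw sw => [|[] w] Lw sw; [by move: sw; rewrite addn3 | |].
      by case/negP: (lang_no_tt Lw); exact: (prefix_infix [:: true; true]).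
    by exists w => //; exact: (suffix_infix [:: true]).
  by exists w; rewrite ?infix_refl.
have [t i2 [lt st]] : exists2 t, infix (false :: t) (false :: s) &
    last false t = false /\ size s <= (size t).+1.
  case/lastP: s i1 s1 => [|s []] i1 s1; first by exists [::].
    exists s; first by rewrite -rcons_cons infix_rcons.
    rewrite size_rcons; split=> //; case/lastP: s i1 {s1} => // s [] i1.
      case/negP: (lang_no_tt Lw); apply: infix_trans i1.
      by rewrite -!cats1 -catA -cat_cons suffix_infix.
    by rewrite last_rcons.
  by exists (rcons s false); rewrite ?infix_refl ?last_rcons.
have i3 := infix_trans i2 i1.
have [|w' E sw'] := sigma_parse _ lt; first exact/lang_no_tt/(lang_infix i3).
exists w'; last by split; [lia | rewrite -E].
by rewrite /desub -E; exact: (lang_infix i3).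
Qed.

End Language.

(** * Words of large exponent *)

(** The exponent is only bounded below and [p] may be any period; exact e-powers are extracted at
    the end by [epower_suffix]. *)
Definition has_power (R : realType) (e : R) (K : nat) (X : seq bool) : Prop :=
  exists (w : seq bool) p, [/\ infix w X, is_period w p, p <= 2 ^ K &
                  (e * p%:R <= (size w)%:R)%R].

(** One [K] bounds both window and period; powers of 2 fit because a decoding step at most doubles
    |u| + |v|. *)
Definition powerful (R : realType) (e : R) (K : nat) (L : seq bool -> Prop) :=
  forall X, L X -> 2 ^ K <= size X -> has_power e K X.

Lemma has_power_le (R : realType) (e : R) K1 K2 X :
  K1 <= K2 -> has_power e K1 X -> has_power e K2 X.
Proof.
move=> K12 [w [p [i1 i2 i3 i4]]]; exists w, p; split=> //.
by apply: leq_trans i3 _; rewrite leq_exp2l.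
Qed.

Lemma powerful_le (R : realType) (e : R) K1 K2 L :
  K1 <= K2 -> powerful e K1 L -> powerful e K2 L.
Proof.
move=> K12 h X LX sX; apply: (has_power_le K12); apply: h => //.
by apply: leq_trans sX; rewrite leq_exp2l.
Qed.

Lemma prefix_period u w : 0 < size u <= size w -> prefix w (u ++ w) ->
  is_period w (size u).
Proof.
move=> /andP[u0 uw] /prefixP[t E]; split=> // i iw.
transitivity (nth false (u ++ w) (i + size u)).
  by rewrite nth_cat ltnNge leq_addl /= addnK.
by rewrite E nth_cat iw.
Qed.

Lemma flatten_nseqC (u : seq bool) m : u ++ flatten (nseq m u) = flatten (nseq m u) ++ u.
Proof. by elim: m => [|m IH] /=; rewrite ?cats0 // {1}IH catA. Qed.

Lemma flatten_nseq_prefix (u : seq bool) m c : prefix c (u ++ c) ->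
  prefix (flatten (nseq m u) ++ c) (u ++ flatten (nseq m u) ++ c).
Proof. by move=> h; rewrite catA flatten_nseqC -catA prefix_catr ?eqxx. Qed.

Lemma size_flatten_nseq (u : seq bool) m : size (flatten (nseq m u)) = m * size u.
Proof. by rewrite size_flatten /shape map_nseq sumn_nseq mulnC. Qed.

Lemma prefix_comparable (s1 s2 s : seq bool) : size s1 <= size s2 ->
  prefix s1 s -> prefix s2 s -> prefix s1 s2.
Proof.
move=> le; rewrite !prefixE => /eqP E1 /eqP <-.
by rewrite take_takel ?E1.
Qed.

(** This gives u^m c the period |u|. If c = u c', then c' and u c' are both prefixes of vu. *)
Lemma central_prefix (u v c : seq bool) :
  prefix c (u ++ v) -> prefix c (v ++ u) -> prefix c (u ++ c).
Proof.
move=> c1 c2; have [le|/ltnW le] := leqP (size c) (size u).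
  exact/prefix_catl/(prefix_comparable le c1)/prefix_prefix.
have /prefixP[c' Ec] := prefix_comparable le (prefix_prefix u v) c1.
move: c1 c2; rewrite Ec prefix_catr // eqxx /= => c1 c2.
rewrite prefix_catr // eqxx /=; apply: prefix_comparable c2.
  by rewrite size_cat leq_addl.
exact: prefix_catl.
Qed.

(** * States reached by decoding *)

(* The word c below is the longest common prefix of uv and vu; d counts the
   decoding steps leading from L0 to L. *)
Record state (d : nat) (L0 L : seq bool -> Prop) (u v : seq bool) : Prop := State {
  state_lang : sturm_lang L;
  state_sizel : 0 < size u;
  state_sizer : 0 < size v;
  state_size : size u + size v <= 2 ^ d.+1;
  state_central : exists c : seq bool, [/\ prefix c (u ++ v), prefix c (v ++ u) &
                                (size c).+2 = size u + size v];
  state_cover : forall n X, L0 X -> 2 ^ d * (n + 3) <= size X ->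
    exists w, [/\ L w, n <= size w & infix (expand u v w) X] }.

Lemma map_negbK w : map negb (map negb w) = w.
Proof. by apply: mapK; exact: negbK. Qed.

Lemma lang_negb L : sturm_lang L -> sturm_lang (fun w => L (map negb w)).
Proof.
move=> [h1 h2 [b hb] h4]; split.
- by move=> u v w; rewrite !map_cat; exact: h1.
- move=> u v Lu Lv; have [w Lw] := h2 _ _ Lu Lv.
  by exists (map negb w); rewrite !map_cat map_negbK.
- by exists (~~ b); rewrite /= negbK.
- move=> u v suv hu hv; rewrite -[u]map_negbK -[v]map_negbK; congr map.
  by apply: h4; rewrite ?size_map // => b';
    rewrite -[b']negbK -map_rcons.
Qed.

Lemma state_negb d L0 L u v :
  state d L0 L u v -> state d L0 (fun w => L (map negb w)) v u.
Proof.
move=> [h1 h2 h3 h4 [c [c1 c2 c3]] h6]; split=> //; rewrite 1?addnC //.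
- exact: lang_negb.
- by exists c; split=> //; rewrite addnC.
- move=> n X LX sX; have [w [w1 w2 w3]] := h6 n X LX sX.
  by exists (map negb w); rewrite map_negbK size_map expand_negb.
Qed.

(** The new central word is u c, since uuv and uvu share u followed by the common prefix of uv and
    vu. The covering bound is stable because 2 (n + 3) = (2 n + 3) + 3. *)
Lemma state_desub d L0 L u v : ~ L [:: true; true] ->
  state d L0 L u v -> state d.+1 L0 (desub L) u (u ++ v).
Proof.
move=> no [h1 h2 h3 h4 [c [c1 c2 c3]] h6]; split=> //.
- exact: desub_lang.
- by rewrite size_cat; lia.
- by rewrite size_cat expnS; lia.
- exists (u ++ c); rewrite size_cat -!catA !prefix_catr ?eqxx //; split=> //.
  by rewrite size_cat; lia.
- move=> n X LX sX; have [|w [w1 w2 w3]] := h6 (2 * n + 3) X LX.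
    by apply: leq_trans sX; rewrite expnS mulnAC; lia.
  have [w' Lw' [sw' iw']] := desub_long h1 no w1 w2.
  exists w'; split=> //; apply: infix_trans w3; rewrite -expand_sigma.
  apply/infix_expand/(infix_trans _ iw').
  exact: infix_rcons.
Qed.

Lemma power_of_run (R : realType) (e : R) d L0 L u v m c X :
  state d L0 L u v -> prefix c (u ++ c) -> 0 < m ->
  infix (flatten (nseq m u) ++ c) X ->
  (e * (size u)%:R <= (m * size u + size c)%:R)%R ->
  has_power e d.+1 X.
Proof.
move=> st pc m0 iX le.
exists (flatten (nseq m u) ++ c), (size u); split=> //.
- apply: prefix_period; last exact: flatten_nseq_prefix.
  rewrite size_cat size_flatten_nseq (state_sizel st) /=.
  by case: m m0 {iX le} => // m _; rewrite mulSn -addnA leq_addr.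
- by apply: leq_trans (state_size st); exact: leq_addr.
- by rewrite size_cat size_flatten_nseq.
Qed.

Lemma rcons_nseq m (b : bool) : rcons (nseq m b) b = nseq m.+1 b.
Proof. by elim: m => //= m ->. Qed.

Lemma desub_nseq L m : desub L (nseq m false) = L (nseq m.+1 false).
Proof.
rewrite /desub /sigma expand_nseq -rcons_nseq; congr (L (rcons _ _)).
by elim: m => //= m ->.
Qed.

Lemma sigma_infix u w : infix u w ->
  infix (rcons (sigma u) false) (rcons (sigma w) false).
Proof.
move=> /infixP[p [s ->]]; rewrite /sigma !expand_cat !rcons_cat.
apply: infix_catl; suff [t ->] : exists t, rcons (sigma s) false = false :: t.
  by rewrite -cat_rcons prefix_infix.
by case: s => [|[] s]; eexists.
Qed.

Lemma run_max L n : L [::] -> ~ L (nseq n false) ->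
  exists m, [/\ m < n, L (nseq m false) & ~ L (nseq m.+1 false)].
Proof.
move=> Le; elim: n => // n IH nL; have [Ln|/IH[m [mn h1 h2]]] := pselect (L (nseq n false)).
  by exists n.
by exists m; split=> //; exact: ltnW.
Qed.

(** Each decoding shortens the longest run of 0 by one and puts one more u in front of v, so m - 1
    of them leave the pair (u, u^(m-1) v). *)
Lemma next_state m d L0 L u v : state d L0 L u v -> 0 < m ->
  L (nseq m false) -> ~ L (nseq m.+1 false) ->
  exists L' v', [/\ state (d + m.-1) L0 L' u v', ~ L' (nseq 2 false) &
                    size v' = m.-1 * size u + size v].
Proof.
elim: m d L v => // -[|m] IH d L v st _ Lm Lm1; first by exists L, v; rewrite addn0.
have hL := state_lang st.
have no : ~ L [:: true; true].
  apply: (no_ff_tt hL); apply: (lang_infix hL) Lm.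
  exact: (prefix_infix [:: false; false]).
have [| | |L' [v' [st' L'2 sv']]] := IH _ _ _ (state_desub no st) => //.
- by rewrite desub_nseq.
- by rewrite desub_nseq.
exists L', v'; split=> //; first by move: st'; rewrite /= addSnnS.
by rewrite sv' size_cat /= mulSn; lia.
Qed.

(** * Large powers in every long word, according to the longest run of 0 *)

Section Powers.
Context (R : realType) (e : R) (e4 : (e <= 4)%R) (L0 : seq bool -> Prop).

Lemma powerful_run d L u v : state d L0 L u v -> L (nseq 6 false) ->
  powerful e (d + 4) L0.
Proof.
move=> st L6 X LX sX; have hL := state_lang st.
(* 13 + 3 = 2^4, and 10 letters already force 0^5, that is, u^5 in [X]. *)
have [|w [Lw sw iw]] := state_cover st (n := 13) LX.
  by rewrite -[13 + 3]/(2 ^ 4) -expnD.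
have i5 : infix (nseq 5 false) w by apply: long_run L6 Lw _ => //; lia.
apply: (@has_power_le _ _ d.+1); first by lia.
have iX : infix (flatten (nseq 5 u) ++ [::]) X.
  by rewrite cats0 -(expand_nseq u v); exact: infix_trans (infix_expand _ _ i5) iw.
apply: (power_of_run st _ _ iX); rewrite ?prefix0s //.
rewrite /= addn0 natrM; apply: ler_wpM2r => //.
by apply: le_trans e4 _; rewrite ler_nat.
Qed.

(* Each decoding step shortens the runs of 0 by one, so that a long word avoiding
   0^m ends up as a long run of 1. *)
Lemma powerful_avoid m d L u v w : state d L0 L u v -> 0 < m ->
  (1 < m -> L (nseq m false)) -> L w -> ~~ infix (nseq m false) w ->
  2 ^ (m + 3) <= size w + 3 -> powerful e (d + m + 3) L0.
Proof.
elim: m d L v w => // -[|m] IH d L v w st _ Lm Lw nw sw.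
  have Ew : w = nseq (size w) true.
    apply/all_pred1P/allP => -[] // fw.
    by move: nw; rewrite infix1s fw.
  rewrite addn1 addSnnS; apply: (powerful_run (state_negb st)); rewrite map_nseq.
  apply: (lang_infix (state_lang st)) Lw; rewrite Ew.
  have -> : size w = 6 + (size w - 6) by move: sw => /=; lia.
  by rewrite nseqD prefix_infix.
have no : ~ L [:: true; true].
  apply: (no_ff_tt (state_lang st)).
  apply: (lang_infix (state_lang st)) (Lm isT).
  exact: (prefix_infix [:: false; false]).
have [|w' Lw' [sw' iw']] := @desub_long _ (state_lang st) no w (2 ^ (m.+1 + 3) - 3) Lw.
  have : 2 ^ 3 <= 2 ^ (m.+1 + 3) by rewrite leq_exp2l // leq_addl.
  by move: sw; rewrite addSn expnS; lia.
have -> : d + m.+2 + 3 = d.+1 + m.+1 + 3 by lia.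
apply: (IH _ _ _ w' (state_desub no st)) => //.
- by move=> _; rewrite desub_nseq; exact: Lm.
- apply: contra nw => /sigma_infix h; apply: infix_trans iw'.
  by move: h; rewrite /sigma expand_nseq -(expand_nseq _ [:: true]) expand_id rcons_nseq.
- by lia.
Qed.

Lemma powerful_freq m d L u v : state d L0 L u v -> 1 < m <= 5 ->
  L (nseq m false) -> ~ L (nseq m.+1 false) ->
  (e * (size u)%:R + 2 <= (m.+1 * size u + size v)%:R)%R ->
  powerful e (d + 10) L0.
Proof.
move=> st /andP[m1 m5] Lm Lm1 le; have hL := state_lang st.
have no : ~ L [:: true; true].
  apply: (no_ff_tt hL); apply: (lang_infix hL) Lm.
  by rewrite -(subnKC m1); exact: (prefix_infix [:: false; false]).
(* Either some long word avoids 0^m, or 0^m occurs in every word of 256 = 2^(5+3) letters. The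
   window of 258 letters below keeps two more to follow the run. *)
have [[w [Lw nw sw]]|noavoid] := pselect (exists w,
    [/\ L w, ~~ infix (nseq m false) w & 2 ^ (m + 3) <= size w + 3]).
  apply: (@powerful_le _ _ (d + m + 3)); first by lia.
  by apply: (powerful_avoid st _ _ Lw) => //; exact: ltnW.
move=> X LX sX; have [|w [Lw sw iw]] := state_cover st (n := 258) LX.
  apply: leq_trans sX; rewrite expnD leq_mul2l; apply/orP; right.
  by vm_compute.
have [p [s Es]] : exists p s, take 256 w = p ++ nseq m false ++ s.
  apply/infixP; case: (boolP (infix _ _)) => // nw.
  case: noavoid; exists (take 256 w); split=> //.
    by apply: (lang_infix hL) Lw; exact: infix_take.
  apply: leq_trans (leq_addr _ _); rewrite size_takel; last by lia.
  by rewrite -[256]/(2 ^ (5 + 3)) leq_exp2l // leq_add2r.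
(* The run of m zeros is maximal, so a 1 follows, and then a 0 because 11 is absent. *)
have [t Et] : exists t, s ++ drop 256 w = true :: false :: t.
  have : 1 < size (s ++ drop 256 w) by rewrite size_cat size_drop; lia.
  have := Lw; rewrite -{1}(cat_take_drop 256 w) Es -!catA.
  case: (s ++ _) => [|[] [|[] t]] // Lw' _.
  - case: no; apply: (lang_infix hL) Lw'; do 2!apply: infix_catl.
    exact: (prefix_infix [:: true; true]).
  - by exists t.
  - case: Lm1; apply: (lang_infix hL) Lw'; apply: infix_catl.
    by rewrite -rcons_nseq -cat_rcons prefix_infix.
  - case: Lm1; apply: (lang_infix hL) Lw'; apply: infix_catl.
    by rewrite -rcons_nseq -cat_rcons prefix_infix.
have [c [c1 c2 c3]] := state_central st.
apply: (@has_power_le _ _ d.+1); first by lia.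
apply: (power_of_run (m := m) (c := c) st) => //; last 1 first.
- move: le; have -> : m.+1 * size u + size v = m * size u + size c + 2.
    by rewrite mulSn; lia.
  by rewrite natrD lerD2r.
- exact: central_prefix c1 c2.
- exact: ltnW.
(* The word 0^m 10 expands to u^m vu, and c is a prefix of vu. *)
- apply: infix_trans iw; apply: (@infix_trans _ (expand u v (nseq m false ++ [:: true; false]))).
    have /prefixP[t' E'] := c2.
    rewrite expand_cat expand_nseq /expand /= cats0 E' catA; exact: prefix_infix.
  apply: infix_expand; rewrite -(cat_take_drop 256 w) Es -!catA Et; apply: infix_catl.
  rewrite -[true :: false :: t]/([:: true; false] ++ t) [X in infix _ X]catA.
  exact: prefix_infix.
Qed.

Lemma powerful_or_run d L u v : state d L0 L u v -> ~ L [:: true; true] ->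
  powerful e (d + 10) L0 \/
  exists m, [/\ 1 < m <= 5, L (nseq m false) & ~ L (nseq m.+1 false)].
Proof.
move=> st no; have hL := state_lang st.
have [L6|nL6] := pselect (L (nseq 6 false)).
  by left; apply: (powerful_le _ (powerful_run st L6)); rewrite leq_add2l.
have [m [m6 Lm Lm1]] := run_max (lang_nil hL) nL6.
have [m1|m1] := ltnP 1 m; first by right; exists m; split=> //; rewrite m1.
left; have L1 : L [:: false].
  have [[] // Lb] := lang_letter hL.
  have [[] //] := lang_extr hL Lb; apply: (lang_infix hL).
  exact: (suffix_infix [:: true]).
have {m1 m6} Em : m = 1 by case: m m1 Lm1 {Lm m6} => [|[]].
(* With neither 00 nor 11 in [L], the decoded language contains no 0: a word of 13 letters avoids
   0^1, and 13 + 3 = 2^(1+3). *)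
rewrite {}Em in Lm1 Lm; have st1 := state_desub no st.
have [w [sw Lw]] := lang_extrn (state_lang st1) 13 (lang_nil (state_lang st1)).
apply: (powerful_le _ (powerful_avoid st1 (m := 1) _ _ Lw _ _)) => //.
- by lia.
- apply/negP => /(lang_infix (state_lang st1))/(_ Lw).
  by rewrite desub_nseq.
- by rewrite sw.
Qed.

(** Long u makes the two letters missing from the central word negligible. A round takes m - 1 <= 4
    decodings and then exchanges the letters, so (u, v) becomes (u^(m-1) v, u) and both length
    bounds rise by one. *)
Lemma state_growth n d L u v : state d L0 L u v -> ~ L [:: true; true] ->
  powerful e (d + 4 * n + 10) L0 \/
  exists d' L' u' v', [/\ d' <= d + 4 * n, state d' L0 L' u' v',
    ~ L' [:: true; true], n < size u' & n <= size v'].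
Proof.
elim: n d L u v => [|n IH] d L u v st no.
  by right; exists d, L, u, v; rewrite addn0; split=> //; exact: state_sizel st.
have [|[d' [L' [u' [v' [dd st' no' su sv]]]]]] := IH _ _ _ _ st no.
  by move=> h; left; apply: powerful_le h; lia.
have [h|[m [/andP[m1 m5] Lm Lm1]]] := powerful_or_run st' no'.
  by left; apply: powerful_le h; lia.
have [L2 [v2 [st2 no2 sv2]]] := next_state st' (ltnW m1) Lm Lm1.
right; exists (d' + m.-1), (fun w => L2 (map negb w)), v2, u'; split=> //.
- by lia.
- exact: state_negb.
- have := state_sizer st'; rewrite sv2.
  have : size u' <= m.-1 * size u' by rewrite leq_pmull //; lia.
  by lia.
Qed.

End Powers.

(** * The golden ratio and a bound uniform in the language *)

Lemma golden (R : realType) : exists t : R,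
  [/\ (0 < t < 1)%R, (t * t = 1 - t)%R & ((5 + Num.sqrt 5) / 2 = 3 + t)%R].
Proof.
have s5 : (Num.sqrt 5 * Num.sqrt 5 = 5 :> R)%R by rewrite -expr2 sqr_sqrtr.
have s0 : (0 <= Num.sqrt 5 :> R)%R by exact: sqrtr_ge0.
exists ((Num.sqrt 5 - 1) / 2)%R; split; [apply/andP; split; nra | nra | lra].
Qed.

Lemma powerful_ratio (R : realType) (e t : R) d L0 L u v :
  (0 < t < 1)%R -> (e < 3 + t)%R -> state d L0 L u v -> ~ L [:: true; true] ->
  (2 <= (3 + t - e) * (size u)%:R)%R -> 1 < size v ->
  (t * (size u)%:R <= (size v)%:R)%R ->
  powerful e (d + 10) L0.
Proof.
move=> /andP[t0 t1] et st no big sv ratio.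
have e4 : (e <= 4)%R by lra.
have [//|[m [m5 Lm Lm1]]] := powerful_or_run e4 st no.
apply: (powerful_freq e4 st m5 Lm Lm1).
rewrite natrD natrM.
have u0 : (0 <= (size u)%:R :> R)%R by [].
have v2 : (2 <= (size v)%:R :> R)%R by rewrite ler_nat.
(* For m >= 3 the exponent is at least 4, as |v| >= 2. For m = 2 it is 3 + |v|/|u| - 2/|u|, and
   2/|u| is at most 3 + t - e. *)
have [m3|m2] := leqP 3 m.
  have : (4 <= m.+1%:R :> R)%R by rewrite ler_nat.
  by nra.
have -> : m = 2 by move: m5 m2 => /andP[]; lia.
by nra.
Qed.

Lemma initial_state L : sturm_lang L -> state 0 L L [:: false] [:: true].
Proof.
move=> hL; split=> //; first by exists [::].
move=> n X LX; rewrite expn0 mul1n => sX; exists X.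
by rewrite expand_id infix_refl; split=> //; lia.
Qed.

Lemma uniformly_powerful (R : realType) (e : R) :
  (e < (5 + Num.sqrt 5) / 2)%R ->
  exists K, forall L, sturm_lang L -> powerful e K L.
Proof.
have [t [t01 tt ->]] := golden R => et; have /andP[t0 t1] := t01.
have e4 : (e <= 4)%R by lra.
have [B HB] : exists B : nat, forall n, B <= n -> (2 <= (3 + t - e) * n%:R)%R.
  exists (Num.bound (2 / (3 + t - e)))%R => n Bn.
  have d0 : (0 < 3 + t - e)%R by lra.
  rewrite mulrC -ler_pdivrMr //; apply: le_trans (ltW (archi_boundP _)) _.
    by rewrite divr_ge0 // ltW.
  by rewrite ler_nat.
(* [state_growth] with n = B + 2 costs 4 (B + 2) decodings, the final change of pair one more, and
   [powerful_ratio] adds 10. *)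
exists (4 * (B + 2) + 11) => L0 hL.
(* 00 and 11 are not both present, so exchanging the letters if necessary removes 11. *)
have [L [u [v [st no]]]] : exists L u v, state 0 L0 L u v /\ ~ L [:: true; true].
  have st := initial_state hL.
  have [Ltt|no] := pselect (L0 [:: true; true]); last by do 3!eexists; exact: conj st no.
  do 3!eexists; split; first exact: state_negb st.
  by move/(no_ff_tt hL).
have [h|[d [M [{}u [{}v [dB {}st {}no uB vB]]]]]] := state_growth e4 (B + 2) st no.
  by apply: powerful_le h; lia.
have v1 : 1 < size v by lia.
have Bu : (2 <= (3 + t - e) * (size u)%:R)%R by apply: HB; lia.
have [ratio|ratio] := lerP (t * (size u)%:R) (size v)%:R.
  by apply: powerful_le (powerful_ratio t01 et st no Bu v1 ratio); lia.
have [h|[m [/andP[m1 m5] Lm Lm1]]] := powerful_or_run e4 st no.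
  by apply: powerful_le h; lia.
have v2 : (2 <= (size v)%:R :> R)%R by rewrite ler_nat.
have u0 : (0 <= (size u)%:R :> R)%R by [].
have [m3|m2] := leqP 3 m.
  apply: powerful_le (powerful_freq e4 st _ Lm Lm1 _); [by lia | by rewrite m1 |].
  have : (4 <= m.+1%:R :> R)%R by rewrite ler_nat.
  by rewrite natrD natrM; nra.
have {m1 m5 m2} Em : m = 2 by lia.
rewrite {}Em in Lm Lm1.
(* Here |v| < t |u|. One decoding and an exchange give lengths |u| + |v| and |u|, and t (|u| + |v|)
   < (t + t^2) |u| = |u|, so the new ratio is large enough. *)
have [L2 [v' [/state_negb st2 no2 sv']]] := @next_state 2 _ _ _ _ _ st isT Lm Lm1.
have Ev : ((size v')%:R = (size u)%:R + (size v)%:R :> R)%R by rewrite sv' mul1n natrD.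
apply: powerful_le (powerful_ratio t01 et st2 no2 _ _ _).
- by move: dB => /=; lia.
- by apply: HB; rewrite sv'; lia.
- by lia.
- by rewrite Ev; nra.
Qed.

(** * Factors of a Sturmian word *)

Definition shift (x : nat -> bool) (M i : nat) : bool := x (M + i).

Lemma size_factor x i n : size (factor x i n) = n.
Proof. exact: size_mkseq. Qed.

Lemma size_factorP x i n : size (factor x i n) == n.
Proof. by rewrite size_factor. Qed.

Definition tfactor x i n : n.-tuple bool := Tuple (size_factorP x i n).

Definition factors (x : nat -> bool) (w : seq bool) : Prop :=
  exists i, factor x i (size w) = w.

Definition factor_set (x : nat -> bool) (n : nat) : {set n.-tuple bool} :=
  [set t : n.-tuple bool | `[< factors x t >]].

Lemma factorsP x i n : factors x (factor x i n).
Proof. by exists i; rewrite size_factor. Qed.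

Lemma factor_cat x i m n : factor x i (m + n) = factor x i m ++ factor x (i + m) n.
Proof.
rewrite /factor /mkseq iotaD map_cat add0n -[m in iota m n]addn0 iotaDl -map_comp.
by congr (_ ++ _); apply: eq_map => j /=; rewrite addnA.
Qed.

Lemma factorS x i n : factor x i n.+1 = rcons (factor x i n) (x (i + n)).
Proof. by rewrite -addn1 factor_cat cats1 /factor /= addn0. Qed.

Lemma factor_shift x M i n : factor (shift x M) i n = factor x (M + i) n.
Proof. by apply: eq_map => j; rewrite /shift addnA. Qed.

Lemma factors_infix x u v w : factors x (u ++ v ++ w) -> factors x v.
Proof.
move=> [i]; rewrite !size_cat !factor_cat => /eqP.
rewrite eqseq_cat ?size_factor // => /andP[_].
rewrite eqseq_cat ?size_factor // => /andP[/eqP h _].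
by exists (i + size u).
Qed.

Lemma factors_tfactor x n (t : n.-tuple bool) : factors x t -> exists i, t = tfactor x i n.
Proof. by move=> [i]; rewrite size_tuple => h; exists i; apply: val_inj. Qed.

Lemma card_sturmian x n : sturmian x -> #|factor_set x n| = n.+1.
Proof.
move=> /(_ n) h; apply/card_eq_II; rewrite card_eq_sym in h; rewrite card_eq_sym.
apply: card_eq_trans h _.
pose f i := val (nth (tfactor x 0 n) (enum (factor_set x n)) i).
have -> : range (fun i => factor x i n) = (f @` `I_#|factor_set x n|)%classic.
  apply/seteqP; split=> [w [i _ <-]|w [i ii <-]].
    have fi : tfactor x i n \in factor_set x n.
      by rewrite inE; apply/asboolP/factorsP.
    exists (index (tfactor x i n) (enum (factor_set x n))); rewrite /=.
      by rewrite cardE index_mem mem_enum.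
    by rewrite /f nth_index ?mem_enum.
  move: ii; rewrite /= cardE => ii; have := mem_nth (tfactor x 0 n) ii.
  rewrite mem_enum inE => /asboolP/factors_tfactor[j Ej].
  by exists j => //; rewrite /f Ej.
apply: inj_card_eq => i j; rewrite !inE /= !cardE => ii jj /val_inj/eqP.
by rewrite nth_uniq ?enum_uniq // => /eqP.
Qed.

(** [E b] collects the words that b can follow. Every factor extends to the right, so the union of
    the two sets is all factors of length n; their intersection is the right special ones. *)
Lemma card_factor_setS x n : #|factor_set x n.+1| =
  #|factor_set x n| + #|[set t : n.-tuple bool | `[< right_special (factors x) t >]]|.
Proof.
pose E b := [set t : n.-tuple bool | `[< factors x (rcons t b) >]].
have -> : [set t : n.-tuple bool | `[< right_special (factors x) t >]] =
    E true :&: E false.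
  apply/setP => t; rewrite !inE; apply/asboolP/andP => [h|[/asboolP h1 /asboolP h2] []//].
  by split; apply/asboolP; apply: h.
have -> : factor_set x n = E true :|: E false.
  apply/setP => t; rewrite !inE; apply/asboolP/orP => [[i]|].
    rewrite size_tuple => Et; have := factorsP x i n.+1; rewrite factorS Et.
    by case: (x _) => h; [left | right]; apply/asboolP.
  by move=> [] /asboolP; rewrite -cats1; apply: (@factors_infix _ [::]).
have injr b : injective (fun t : n.-tuple bool => [tuple of rcons t b]).
  by move=> t t' E1; apply/val_inj/(@rcons_injl _ b); exact: (congr1 val E1).
have -> : factor_set x n.+1 = [set [tuple of rcons t true] | t : n.-tuple bool in E true] :|:
    [set [tuple of rcons t false] | t : n.-tuple bool in E false].
  apply/setP => t; rewrite !inE; apply/asboolP/orP.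
    have [w [b Ew]] : exists w b, val t = rcons w b.
      have : size (val t) = n.+1 := size_tuple t.
      by case/lastP: (val t) => // w b _; exists w, b.
    have sw : size w == n by have := size_tuple t; rewrite Ew size_rcons => -[->].
    have Et : t = [tuple of rcons (Tuple sw) b] by exact: val_inj.
    rewrite Et => h; case: b Et h {Ew} => _ h; [left|right]; apply: imset_f;
      by rewrite inE; apply/asboolP.
  by move=> [] /imsetP[t']; rewrite inE => /asboolP h ->.
rewrite cardsUI -(card_imset _ (injr true)) -(card_imset _ (injr false)) -cardsUI.
rewrite -[LHS]addn0; congr (_ + _); apply/esym/eqP; rewrite cards_eq0.
apply/eqP/setP => t; rewrite !inE; apply/andP => -[/imsetP[t1 _ ->]].
by move=> /imsetP[t2 _ /(congr1 val) /rcons_inj[]].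
Qed.

Lemma sturmian_special x u v : sturmian x -> size u = size v ->
  right_special (factors x) u -> right_special (factors x) v -> u = v.
Proof.
move=> sx suv hu hv.
have /eqP/cards1P[t Et] : #|[set t : (size v).-tuple bool |
    `[< right_special (factors x) t >]]| = 1.
  have := card_factor_setS x (size v); rewrite !card_sturmian //; lia.
have mem w (sw : size w == size v) : right_special (factors x) w -> w = t.
  move=> h; have : Tuple sw \in [set t] by rewrite -Et inE; apply/asboolP.
  by rewrite inE => /eqP <-.
by transitivity (val t); [|apply/esym]; apply: mem => //; rewrite ?suv.
Qed.

Lemma card_eventually_periodic x s p n : 0 < p ->
  (forall t, s <= t -> x t = x (t + p)) -> #|factor_set x n| <= s + p.
Proof.
move=> p0 xp.
have small i : exists j : 'I_(s + p), tfactor x i n = tfactor x j n.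
  have [m] := ubnP i; elim: m i => // m IH i im.
  have [isp|spi] := ltnP i (s + p); first by exists (Ordinal isp).
  have [|j Ej] := IH (i - p); first by lia.
  exists j; rewrite -Ej; apply/val_inj/eq_map => k /=.
  rewrite [in RHS]xp; last by lia.
  by congr (x _); lia.
rewrite -[leqRHS]card_ord.
apply: leq_trans (leq_imset_card (fun j : 'I_(s + p) => tfactor x j n) predT).
apply: subset_leq_card; apply/fintype.subsetP => t; rewrite inE => /asboolP/factors_tfactor[i ->].
by have [j ->] := small i; apply: imset_f.
Qed.

(** Each factor of length n then determines the next letter, and by the pigeonhole principle some
    factor occurs at two positions, after which the word repeats. *)
Lemma eventually_periodic_no_special x n :
  (forall t : n.-tuple bool, ~ right_special (factors x) t) ->
  exists s p, 0 < p /\ forall t, s <= t -> x t = x (t + p).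
Proof.
move=> nrs.
have det i j : tfactor x i n = tfactor x j n -> x (i + n) = x (j + n).
  move=> E; apply/eqP; case: (x (i + n) =P x (j + n)) => // ne; exfalso.
  apply: (nrs (tfactor x i n)) => b.
  have [<-|eb] := eqVneq (x (i + n)) b.
    by rewrite -factorS; exact: factorsP.
  have -> : b = x (j + n) by move: ne eb; case: (x _) (x _) b => -[] [].
  by rewrite E -factorS; exact: factorsP.
pose f (i : 'I_(#|{: n.-tuple bool}|.+1)) := tfactor x i n.
have /injectivePn[i [j ij Ef]] : ~~ injectiveb f.
  by apply/injectiveP => /leq_card; rewrite card_ord ltnn.
wlog {ij} ij : i j Ef / i < j.
  move=> th; case: (ltngtP i j) => [|ji|/val_inj Eij]; first exact: th.
    by apply: (th j i).
  by rewrite Eij eqxx in ij.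
exists (i + n), (j - i); split=> [|t it]; first by rewrite subn_gt0.
have E k : tfactor x (i + k) n = tfactor x (j + k) n.
  elim: k => [|k IH]; first by rewrite !addn0.
  apply/val_inj; rewrite /= !addnS.
  have cons m : x m :: factor x m.+1 n = rcons (factor x m n) (x (m + n)).
    by rewrite -factorS -[n.+1]add1n factor_cat /= /factor /= addn0 addn1.
  have : x (i + k) :: factor x (i + k).+1 n = x (j + k) :: factor x (j + k).+1 n.
    by rewrite !cons (det _ _ IH); congr rcons; exact: (congr1 val IH).
  by case.
have := det _ _ (E (t - (i + n))).
by congr (x _ = x _); lia.
Qed.

(** A shift of [x] has right special factors of every length, since eventual periodicity would bound
    the number of factors of [x]. It therefore has at least n + 1 factors of length n, hence all
    those of [x]. *)
Lemma sturmian_recurrent x v M :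
  sturmian x -> factors x v -> factors (shift x M) v.
Proof.
move=> sx xv.
have sub n : factor_set (shift x M) n \subset factor_set x n.
  apply/fintype.subsetP => t; rewrite !inE => h; have [i ->] := factors_tfactor h.
  by rewrite /= factor_shift; exact: factorsP.
have rs n : 0 < #|[set t : n.-tuple bool | `[< right_special (factors (shift x M)) t >]]|.
  rewrite lt0n; apply/eqP => /cards0_eq E.
  have [|s [p [p0 per]]] := @eventually_periodic_no_special (shift x M) n.
    by move=> t /asboolP rt; have := finset.in_set0 t; rewrite -E finset.inE rt.
  have := @card_eventually_periodic x (M + s) p (M + s + p) p0.
  rewrite card_sturmian // ltnn => /(_ _)/notF; apply=> t st.
  have := per (t - M); rewrite /shift => h.
  have := h _; rewrite addnA subnKC; last by lia.
  by apply; lia.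
have card n : n < #|factor_set (shift x M) n|.
  elim: n => [|n IH]; last first.
    by rewrite card_factor_setS; have := rs n; lia.
  rewrite card_gt0; apply/set0Pn; exists (tfactor (shift x M) 0 0).
  by rewrite inE; apply/asboolP/factorsP.
have E : factor_set (shift x M) (size v) = factor_set x (size v).
  by apply/eqP; rewrite eqEcard sub card_sturmian //=.
have : in_tuple v \in factor_set x (size v) by rewrite inE; apply/asboolP.
by rewrite -E inE => /asboolP.
Qed.

Lemma sturmian_lang x : sturmian x -> sturm_lang (factors x).
Proof.
move=> sx; split.
- exact: factors_infix.
- move=> u v [i Eu] /(sturmian_recurrent (i + size u) sx)[j].
  rewrite factor_shift => Ev; exists (factor x (i + size u) j), i.
  by rewrite !size_cat size_factor !factor_cat Eu Ev.
- by exists (x 0); exists 0.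
- by move=> u v; exact: sturmian_special.
Qed.

(** * From large exponents to ending positions *)

(* The suffix of length ceil (e p) is an e-power unless its period q is smaller
   than p; it is then long enough to repeat the argument with q. *)
Lemma epower_suffix (R : realType) (e : R) v p : (1 <= e)%R -> is_period v p ->
  (e * p%:R <= (size v)%:R)%R ->
  exists w : seq bool, [/\ suffix w v, epower e w & per w <= p].
Proof.
move=> e1; have [n] := ubnP p; elim: n p v => // n IH p v pn [p0 pv vp] le.
have p0R : (0 < p%:R :> R)%R by rewrite ltr0n.
have c0 : (0 < Num.ceil (e * p%:R))%R by rewrite ceil_gt0; nra.
case Ec : (Num.ceil (e * p%:R)) c0 => [m|//] m0.
have pm : p <= m.
  have := Num.Theory.ceil_ge (e * p%:R)%R; rewrite Ec => h.
  by rewrite -(ler_nat R); apply: le_trans h; nra.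
have mv : m <= size v.
  by rewrite -lez_nat -Ec ceil_le_int.
pose w := drop (size v - m) v.
have sw : size w = m by rewrite size_drop subKn.
have wp : is_period w p.
  split=> //; rewrite sw // => i im; rewrite !nth_drop vp; last by lia.
  by congr (nth _ _ _); lia.
have [|[q0 qw wq] min] := @perP w; first by rewrite sw.
have := min p wp; rewrite leq_eqVlt => /predU1P[Ep|qp].
  exists w; split; [exact: suffix_drop | | by rewrite Ep].
  by split; rewrite sw // Ep.
have [|||w' [w1 w2 w3]] := IH (per w) w; [lia | by [] | | ].
  rewrite sw; apply: (@le_trans _ _ (e * p%:R)%R).
    by apply: ler_wpM2l; rewrite ?ler_nat; [lra | lia].
  by have := Num.Theory.ceil_ge (e * p%:R)%R; rewrite Ec.
exists w'; split=> //; last by lia.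
exact: suffix_trans w1 (suffix_drop _ _).
Qed.

Lemma unbounded_infinite (P : set nat) :
  (forall i, exists2 n, P n & i < n) -> infinite_set P.
Proof.
move=> unb /finite_seqP[s Es]; have [n] := unb (\max_(i <- s) i).
by rewrite Es /= => ns; rewrite ltnNge (@leq_bigmax_seq _ s xpredT (fun i => i) n).
Qed.

Theorem theorem2 (R : realType) (e : R)
    (he : (1 <= e < (5 + Num.sqrt 5) / 2)%R) :
  exists N k : nat, forall x : nat -> bool,
    sturmian x -> max_gap_le (ending_positions e k x) N.
Proof.
have /andP[e1 /uniformly_powerful[K HK]] := he.
exists (2 ^ K), (2 ^ K) => x /sturmian_lang/HK hx.
(* Some e-power lies within the 2^K letters starting at i, so it ends at most 2^K after i; with i an
   ending position this bounds the gap. *)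
have ends i : exists2 n, ending_positions e (2 ^ K) x n & i < n <= i + 2 ^ K.
  have [|w [p [iw wp pK le]]] := hx _ (factorsP x i (2 ^ K)).
    by rewrite size_factor.
  have [w' [sw' ew' pw']] := epower_suffix e1 wp le.
  have [a [b Ew]] : exists a b : seq bool, factor x i (2 ^ K) = a ++ w' ++ b.
    exact/infixP/(infix_trans (suffixW sw') iw).
  have [w0 _] := ew'.
  have sz : 2 ^ K = size a + (size w' + size b).
    by rewrite -!size_cat -Ew size_factor.
  have Ew' : factor x (i + size a) (size w') = w'.
    move: Ew; rewrite sz !factor_cat => /eqP.
    rewrite eqseq_cat ?size_factor // => /andP[_].
    by rewrite eqseq_cat ?size_factor // => /andP[/eqP].
  exists (i + size a + size w'); last by apply/andP; split; lia.
  exists (size w'); rewrite addnK Ew'; split=> //; last exact: leq_trans pK.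
  by rewrite w0 leq_addl.
split.
  by apply: unbounded_infinite => i; have [n Pn /andP[? _]] := ends i; exists n.
move=> p q Pp Pq pq gap; have [n Pn /andP[pn nN]] := ends p.
have [qn|nq] := leqP q n; first by lia.
by case: (gap n) => //; rewrite pn.
Qed.
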